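(* For $b,c\in\mathbb{R}$ let $E_{1,r}(b,c)$ (with $bc\neq 1$), $E_{2,r}(b)$, $E_{3,r},\dots,E_{7,r}$ be the 2-dimensional real evolution algebras with the matrices of structure constants given in the context. The following equalities hold: \[\mathrm{Aut}(E_{1,r}(b,c))=\{I\}\ \text{ if } bc\neq 1 \text{ and } b\ne c,\qquad \mathrm{Aut}(E_{1,r}(b,b))=\left\{I,\begin{pmatrix}0&1\\1&0\end{pmatrix}\right\}\ \text{ if } b^2\ne1,\] \[\mathrm{Aut}(E_{2,r}(b))=\{I\}\ \text{ if } b\ne0,\qquad \mathrm{Aut}(E_{2,r}(0))=\left\{\begin{pmatrix}1&0\\ t&1-t\end{pmatrix}:\ t\in\mathbb{R},\ t\ne1\right\},\] \[\mathrm{Aut}(E_{3,r})=\left\{I,\begin{pmatrix}0&1\\1&0\end{pmatrix}\right\},\qquad \mathrm{Aut}(E_{4,r})=\mathrm{Aut}(E_{5,r})=\left\{I,\begin{pmatrix}1&0\\0&-1\end{pmatrix}\right\},\] \[\mathrm{Aut}(E_{6,r})=\left\{\begin{pmatrix}t&1-t\\ 1-t&t\end{pmatrix}:\ t\in\mathbb{R},\ t\ne\tfrac12\right\},\qquad \mathrm{Aut}(E_{7,r})=\left\{\begin{pmatrix}t^2&s\\0&t\end{pmatrix}:\ t,s\in\mathbb{R},\ t\ne0\right\}.\]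
   Context: A 2-dimensional real algebra is given, with respect to a basis $(e_1,e_2)$, by its $2\times4$ matrix of structure constants (MSC) $E$, whose columns are, in order, the coordinate columns of $e_1e_1,\ e_1e_2,\ e_2e_1,\ e_2e_2$. For an algebra with MSC $E$, its automorphism group is presented as \[\mathrm{Aut}(E)=\{g\in GL(2,\mathbb{R}):\ gE-E(g\otimes g)=0\},\] where $\otimes$ is the Kronecker product. $I$ denotes the $2\times2$ identity matrix. The algebras are \[E_{1,r}(b,c)=\begin{pmatrix}1&0&0&b\\ c&0&0&1\end{pmatrix}\ (bc\ne1),\quad E_{2,r}(b)=\begin{pmatrix}1&0&0&b\\ 1&0&0&0\end{pmatrix},\quad E_{3,r}=\begin{pmatrix}0&0&0&1\\ 1&0&0&0\end{pmatrix},\] \[E_{4,r}=\begin{pmatrix}1&0&0&1\\ 0&0&0&0\end{pmatrix},\quad E_{5,r}=\begin{pmatrix}1&0&0&-1\\ 0&0&0&0\end{pmatrix},\quad E_{6,r}=\begin{pmatrix}1&0&0&-1\\ -1&0&0&1\end{pmatrix},\quad E_{7,r}=\begin{pmatrix}0&0&0&1\\ 0&0&0&0\end{pmatrix}.\] *)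

(* Defs.v *)
From mathcomp Require Import all_boot all_order all_algebra.
From mathcomp Require Import classical_sets reals.
From mathcomp Require Import mxtens.

Set Implicit Arguments.
Unset Strict Implicit.
Unset Printing Implicit Defensive.

Import Order.TTheory GRing.Theory Num.Theory.

Local Open Scope ring_scope.
Local Open Scope classical_set_scope.

(* The m x n matrix whose rows are listed in s; entries missing from s are 0. *)
Definition mx_of_rows (R : realType) (m n : nat) (s : seq (seq R)) : 'M[R]_(m, n) :=
  \matrix_(i, j) nth 0 (nth [::] s i) j.

Definition mx22 (R : realType) (a b c d : R) : 'M[R]_2 :=
  mx_of_rows 2 2 [:: [:: a; b]; [:: c; d]].

(* Column 2 * i + j (with i, j in {0, 1}) holds the coordinates of
   e_(i+1) e_(j+1); this is the index convention of the Kronecker product *t. *)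
Definition MSC (R : realType) := 'M[R]_(2, 2 * 2).

Definition mx24 (R : realType) (a1 a2 a3 a4 b1 b2 b3 b4 : R) : MSC R :=
  mx_of_rows 2 (2 * 2) [:: [:: a1; a2; a3; a4]; [:: b1; b2; b3; b4]].

Definition Aut (R : realType) (E : MSC R) : set 'M[R]_2 :=
  [set g : 'M[R]_2 | g \in unitmx /\ g *m E - E *m (g *t g) = 0].

Definition E1 (R : realType) (b c : R) : MSC R :=
  mx24 1 0 0 b
       c 0 0 1.

Definition E2 (R : realType) (b : R) : MSC R :=
  mx24 1 0 0 b
       1 0 0 0.

Definition E3 (R : realType) : MSC R :=
  mx24 0 0 0 1
       1 0 0 0.

Definition E4 (R : realType) : MSC R :=
  mx24 1 0 0 1
       0 0 0 0.

Definition E5 (R : realType) : MSC R :=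
  mx24 1 0 0 (-1)
       0 0 0 0.

Definition E6 (R : realType) : MSC R :=
  mx24 1 0 0 (-1)
       (-1) 0 0 1.

Definition E7 (R : realType) : MSC R :=
  mx24 0 0 0 1
       0 0 0 0.

(* Main.v *)
(* Write g = (p q; r s) and E = (a 0 0 b; c 0 0 d). The middle columns of
   gE = E(g (x) g) say that (pq, rs) lies in the kernel of (a b; c d). When
   this matrix is invertible, pq = rs = 0, so g is diagonal or antidiagonal and
   the outer columns determine it; the singular cases are solved directly. For
   E6, det g = (p + r)(p - q), and the equations give q = r, then p + r = 1. *)
Require Import Defs.
From mathcomp Require Import all_boot all_order all_algebra.
From mathcomp Require Import classical_sets reals.
From mathcomp Require Import mxtens ring lra.

Import Order.TTheory GRing.Theory Num.Theory.

Local Open Scope ring_scope.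
Local Open Scope classical_set_scope.

Lemma ord2_case (P : 'I_2 -> Prop) : P ord0 -> P ord_max -> forall i, P i.
Proof.
move=> P0 P1 [[|[|//]] ilt].
- by have -> : Ordinal ilt = ord0 by apply: val_inj.
- by have -> : Ordinal ilt = ord_max by apply: val_inj.
Qed.

Lemma mx22_eta (R : realType) (g : 'M[R]_2) :
  g = mx22 (g ord0 ord0) (g ord0 ord_max) (g ord_max ord0) (g ord_max ord_max).
Proof.
by apply/matrixP => i j; rewrite mxE; elim/ord2_case: i; elim/ord2_case: j.
Qed.

Lemma mx22_1 (R : realType) : 1%:M = mx22 1 0 0 1 :> 'M[R]_2.
Proof. by rewrite (mx22_eta _ 1%:M) !mxE. Qed.

Lemma det_mx22 (R : realType) (p q r s : R) : \det (mx22 p q r s) = p * s - q * r.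
Proof.
rewrite (expand_det_row _ ord0) !big_ord_recl big_ord0 /cofactor !det_mx11.
by rewrite !mxE /= expr0 expr1; ring.
Qed.

Lemma mx24_eq0 (R : realType) (x0 x1 x2 x3 y0 y1 y2 y3 : R) :
  mx24 x0 x1 x2 x3 y0 y1 y2 y3 = 0 <->
  [/\ x0 = 0 /\ y0 = 0, x1 = 0 /\ y1 = 0, x2 = 0 /\ y2 = 0 & x3 = 0 /\ y3 = 0].
Proof.
split=> [/matrixP xy0 | [[-> ->] [-> ->] [-> ->] [-> ->]]].
- have col (k : nat) : (k < 4)%N ->
      nth 0 [:: x0; x1; x2; x3] k = 0 /\ nth 0 [:: y0; y1; y2; y3] k = 0.
    move=> k4; have := xy0 ord_max (inord k); have := xy0 ord0 (inord k).
    by rewrite !mxE inordK.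
  by split; [exact: (col 0%N)|exact: (col 1%N)|exact: (col 2%N)|exact: (col 3%N)].
- apply/matrixP => i [j jlt]; rewrite !mxE.
  by elim/ord2_case: i; case: j jlt => [|[|[|[|]]]].
Qed.

(** Only the outer columns of [E] can be nonzero, so [E] meets only the first and last rows of
    [g *t g], namely [p^2, pq, qp, q^2] and [r^2, rs, sr, s^2]. This also makes the two middle
    columns equal. *)
Lemma autom_mx24E (R : realType) (a b c d p q r s : R) :
  let E := mx24 a 0 0 b c 0 0 d in let g := mx22 p q r s in
  g *m E - E *m (g *t g) =
  mx24 (p * a + q * c - (a * p ^+ 2 + b * r ^+ 2))
       (- (a * (p * q) + b * (r * s))) (- (a * (p * q) + b * (r * s)))
       (p * b + q * d - (a * q ^+ 2 + b * s ^+ 2))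
       (r * a + s * c - (c * p ^+ 2 + d * r ^+ 2))
       (- (c * (p * q) + d * (r * s))) (- (c * (p * q) + d * (r * s)))
       (r * b + s * d - (c * q ^+ 2 + d * s ^+ 2)).
Proof.
apply/matrixP => i [j jlt]; rewrite !mxE /= !big_ord_recl !big_ord0 !mxE /=.
elim/ord2_case: i => /=; case: j jlt => [|[|[|[|//]]]] jlt /=.
all: ring.
Qed.

(** With g(e1) = (p, r) and g(e2) = (q, s), the last three clauses say g(e1 e1) = g(e1)g(e1),
    g(e1)g(e2) = 0 and g(e2 e2) = g(e2)g(e2), coordinate by coordinate. The column of e2 e1 repeats
    that of e1 e2 and is dropped. *)
Lemma Aut_mx24P (R : realType) (a b c d p q r s : R) :
  Aut (mx24 a 0 0 b c 0 0 d) (mx22 p q r s) <->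
  [/\ p * s - q * r != 0,
      p * a + q * c = a * p ^+ 2 + b * r ^+ 2 /\
      r * a + s * c = c * p ^+ 2 + d * r ^+ 2,
      a * (p * q) + b * (r * s) = 0 /\ c * (p * q) + d * (r * s) = 0
    & p * b + q * d = a * q ^+ 2 + b * s ^+ 2 /\
      r * b + s * d = c * q ^+ 2 + d * s ^+ 2].
Proof.
rewrite /Aut /= unitmxE det_mx22 unitfE autom_mx24E mx24_eq0; split.
- case=> det0 [[/subr0_eq ? /subr0_eq ?] [/eqP + /eqP +] _ [/subr0_eq ? /subr0_eq ?]].
  by rewrite !oppr_eq0 => /eqP ? /eqP ?; split.
- by case=> ? [-> ->] [-> ->] [-> ->]; rewrite !subrr !oppr0.
Qed.

Lemma mx22_subset (R : realType) (A B : set 'M[R]_2) :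
  (forall p q r s, A (mx22 p q r s) -> B (mx22 p q r s)) -> A `<=` B.
Proof. by move=> AB g; rewrite (mx22_eta _ g); apply: AB. Qed.

Lemma Aut_mx24_1 (R : realType) (a b c d : R) : Aut (mx24 a 0 0 b c 0 0 d) 1%:M.
Proof.
rewrite mx22_1; apply/Aut_mx24P; split; [|split; ring..].
by rewrite mulr1 mulr0 subr0 oner_eq0.
Qed.

(** The cofactor of [x - 1] is (x + 1/2)^2 + 3/4, which is positive over the reals. *)
Lemma cube_root_unity (R : realType) (x : R) : x ^+ 3 = 1 -> x = 1.
Proof.
move=> x3; have /eqP : (x - 1) * (x ^+ 2 + x + 1) = 0
  by rewrite -[RHS](subrr 1) -[X in _ = X - _]x3; ring.
rewrite mulf_eq0 => /orP[/eqP|/eqP]; nra.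
Qed.

(** Of the four ways to annihilate both products, the two others leave a zero column, hence a zero
    determinant. *)
Lemma diag_or_antidiag {R : realType} {p q r s : R} :
  p * s - q * r != 0 -> p * q = 0 -> r * s = 0 ->
  q = 0 /\ r = 0 \/ p = 0 /\ s = 0.
Proof.
move=> det0 /eqP; rewrite mulf_eq0 => /orP[] /eqP pq0 /eqP;
  rewrite mulf_eq0 => /orP[] /eqP rs0; subst;
  by [left|right|rewrite ?(mul0r, mulr0) subrr eqxx in det0].
Qed.

Lemma neq0_idem {R : realType} {x : R} : x != 0 -> x = x ^+ 2 -> x = 1.
Proof. by move=> x0 /(congr1 (fun y => y / x)); rewrite expr2 mulfK // divff. Qed.

(** The product [0 * 0] is what the determinant contains once [q = 0] and [r = 0] are
    substituted. *)
Lemma diag_unit {R : realType} {p s : R} : p * s - 0 * 0 != 0 -> p != 0 /\ s != 0.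
Proof. by rewrite mul0r subr0 mulf_eq0 negb_or => /andP. Qed.

Lemma antidiag_unit {R : realType} {q r : R} : 0 * 0 - q * r != 0 -> q != 0 /\ r != 0.
Proof. by rewrite mul0r sub0r oppr_eq0 mulf_eq0 negb_or => /andP. Qed.

(** One inclusion serves both b different from c and b = c: an antidiagonal solution has q = r = 1,
    and then [h1] becomes c = b. *)
Lemma Aut_E1 {R : realType} {b c : R} : b * c != 1 ->
  Aut (E1 b c) `<=` [set g | g = 1%:M \/ b = c /\ g = mx22 0 1 1 0].
Proof.
move=> bc1; apply: mx22_subset => p q r s /Aut_mx24P[det0 [h1 h2] [h3 h4] [h5 h6]].
have d0 : 1 - b * c != 0 by rewrite subr_eq0 eq_sym.
have pq0 : p * q = 0.
  apply: (mulfI d0).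
  (* Elimination of [r * s]: [h3] minus [b] times [h4]. *)
  transitivity (1 * (p * q) + b * (r * s) - b * (c * (p * q) + 1 * (r * s))); first ring.
  by rewrite h3 h4; ring.
have rs0 : r * s = 0 by move: h4; rewrite pq0; lra.
have [[q0 r0]|[p0 s0]] := diag_or_antidiag det0 pq0 rs0; subst.
- have [p0 s0] := diag_unit det0; left; rewrite mx22_1.
  by rewrite (neq0_idem p0 ltac:(lra)) (neq0_idem s0 ltac:(lra)).
- have [q0 r0] := antidiag_unit det0; right.
  have r1 : r = 1 by apply: neq0_idem => //; lra.
  have q1 : q = 1 by apply: neq0_idem => //; lra.
  by subst; split=> //; lra.
Qed.

Lemma Aut_E2 (R : realType) (b : R) : b != 0 -> Aut (E2 b) = [set 1%:M].
Proof.
move=> b0; apply/seteqP; split; last by move=> _ ->; exact: Aut_mx24_1.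
apply: mx22_subset => p q r s /Aut_mx24P[det0 [h1 h2] [h3 h4] [h5 h6]].
have pq0 : p * q = 0 by lra.
have rs0 : r * s = 0 by apply: (mulfI b0); move: h3; rewrite pq0; lra.
have [[q0 r0]|[p0 s0]] := diag_or_antidiag det0 pq0 rs0; subst.
- have [p0 s0] := diag_unit det0.
  have p1 : p = 1 by apply: neq0_idem => //; lra.
  by rewrite mx22_1 p1; congr mx22; move: h2; rewrite p1; lra.
- have [q0 r0] := antidiag_unit det0.
  (* With p = s = 0, [h2] reduces to r = 0, so no antidiagonal solution exists. *)
  by move: r0; have -> : r = 0; [lra|rewrite eqxx].
Qed.

Lemma Aut_E2_0 (R : realType) :
  Aut (E2 (0 : R)) = [set mx22 1 0 t (1 - t) | t in [set t : R | t != 1]].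
Proof.
apply/seteqP; split.
- apply: mx22_subset => p q r s /Aut_mx24P[det0 [h1 h2] [h3 h4] [h5 h6]].
  (* Here e2 e2 = 0, so g(e2) squares to zero; its square has first coordinate q^2. *)
  have /eqP : q ^+ 2 = 0 by lra.
  rewrite expf_eq0 /= => /eqP q0; subst.
  have /andP[p0 s0] : (p != 0) && (s != 0).
    by move: det0; rewrite mul0r subr0 mulf_eq0 negb_or.
  have p1 : p = 1 by apply: neq0_idem => //; lra.
  (* With p = 1 and q = 0, [h2] gives s = 1 - r; thus r is the parameter, and r = 1 would make s
     vanish. *)
  subst; exists r; last by congr mx22; lra.
  by apply: contra_neq s0 => r1; subst; lra.
- move=> _ [t t1 <-]; apply/Aut_mx24P; split; [|split; ring..].
  by rewrite mul1r mul0r subr0 subr_eq0 eq_sym.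
Qed.

Lemma Aut_E3 (R : realType) : Aut (E3 R) = [set 1%:M; mx22 0 1 1 0].
Proof.
apply/seteqP; split.
- apply: mx22_subset => p q r s /Aut_mx24P[det0 [h1 h2] [h3 h4] [h5 h6]].
  have pq0 : p * q = 0 by lra.
  have rs0 : r * s = 0 by lra.
  have [[q0 r0]|[p0 s0]] := diag_or_antidiag det0 pq0 rs0; subst.
  + have [p0 s0] := diag_unit det0; left.
    have sE : s = p ^+ 2 by lra.
    have p1 : p = 1.
      (* By [h5], p = s^2 = p^4, and one factor p cancels. *)
      apply: cube_root_unity; apply: (mulfI p0).
      by rewrite mulr1 -exprS (exprM p 2 2) -sE; lra.
    by rewrite mx22_1 sE p1 expr1n.
  + have [q0 r0] := antidiag_unit det0; right.
    have rE : r = q ^+ 2 by lra.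
    have q1 : q = 1.
      apply: cube_root_unity; apply: (mulfI q0).
      by rewrite mulr1 -exprS (exprM q 2 2) -rE; lra.
    by rewrite rE q1 expr1n.
- move=> _ [->|->]; first exact: Aut_mx24_1.
  apply/Aut_mx24P; split; [|split; ring..].
  by rewrite mul0r mul1r sub0r oppr_eq0 oner_eq0.
Qed.

(** This treats [E4] (e = 1) and [E5] (e = -1) together: once r = 0, p = 1 and q = 0, [h5] reads e =
    e s^2, from which e cancels whatever its sign. *)
Lemma Aut_e2_sign (R : realType) (e : R) : e != 0 ->
  Aut (mx24 1 0 0 e 0 0 0 0) = [set 1%:M; mx22 1 0 0 (-1)].
Proof.
move=> e0; apply/seteqP; split.
- apply: mx22_subset => p q r s /Aut_mx24P[det0 [h1 h2] [h3 h4] [h5 h6]].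
  have r0 : r = 0 by lra.
  subst; have /andP[p0 s0] : (p != 0) && (s != 0).
    by move: det0; rewrite mulr0 subr0 mulf_eq0 negb_or.
  have p1 : p = 1 by apply: neq0_idem => //; lra.
  subst; have q0 : q = 0 by lra.
  subst; have /eqP : s ^+ 2 = 1 by apply: (mulfI e0); lra.
  by rewrite sqrf_eq1 => /orP[] /eqP ->; [left; rewrite mx22_1|right].
- move=> _ [->|->]; first exact: Aut_mx24_1.
  apply/Aut_mx24P; split; [|split; ring..].
  by rewrite mulr0 subr0 mul1r oppr_eq0 oner_eq0.
Qed.

Lemma Aut_E6 (R : realType) :
  Aut (E6 R) = [set mx22 t (1 - t) (1 - t) t | t in [set t : R | t != 1 / 2]].
Proof.
apply/seteqP; split.
- apply: mx22_subset => p q r s /Aut_mx24P[det0 [h1 h2] [h3 h4] [h5 h6]].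
  (* The rows of [E6] are opposite, so adding [h1] and [h2] cancels all squares. *)
  have sE : s = p + r - q by lra.
  have detE : p * s - q * r = (p + r) * (p - q) by rewrite sE; ring.
  move: det0; rewrite detE mulf_eq0 negb_or => /andP[pr0 pq0].
  have qr : q = r.
    (* [h1] and [h5] give two values of p - q, namely p^2 - r^2 and s^2 - q^2; equate them after
       substituting s. *)
    have /eqP : (p + r) * (q - r) = 0 by move: h5; rewrite sE; lra.
    by rewrite mulf_eq0 (negbTE pr0) /= subr_eq0 => /eqP.
  (* Now [h1] is p - r = (p + r)(p - r), with p - r nonzero. *)
  subst; have pr1 : p + r = 1 by apply: (mulIf pq0); lra.
  have rE : r = 1 - p by lra.
  subst; exists p; last by congr mx22; lra.
  by apply: contra_neq pq0 => ->; field.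
- move=> _ [t t1 <-]; apply/Aut_mx24P; split; [|split; ring..].
  (* The determinant is 2t - 1. *)
  by apply: contra_neq t1 => t1; lra.
Qed.

(** Since e1 = e2 e2, the image of e2 determines g: the square of q e1 + s e2 is s^2 e1, so p = s^2
    and r = 0. *)
Lemma Aut_E7 (R : realType) :
  Aut (E7 R) = [set g : 'M[R]_2 | exists t s : R, t != 0 /\ g = mx22 (t ^+ 2) s 0 t].
Proof.
apply/seteqP; split.
- apply: mx22_subset => p q r s /Aut_mx24P[det0 [h1 h2] [h3 h4] [h5 h6]].
  have r0 : r = 0 by lra.
  subst; exists s, q; split; last by congr mx22; lra.
  by apply: contra_neq det0 => ->; rewrite !mulr0 subr0.
- move=> _ [t [s [t0 ->]]]; apply/Aut_mx24P; split; [|split; ring..].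
  by rewrite mulr0 subr0 mulf_neq0 ?expf_neq0.
Qed.

Theorem theorem3p4 (R : realType) :
  (forall b c : R, b * c != 1 -> b != c -> Aut (E1 b c) = [set 1%:M]) /\
  (forall b : R, b ^+ 2 != 1 -> Aut (E1 b b) = [set 1%:M; mx22 0 1 1 0]) /\
  (forall b : R, b != 0 -> Aut (E2 b) = [set 1%:M]) /\
  Aut (E2 (0 : R)) = [set mx22 1 0 t (1 - t) | t in [set t : R | t != 1]] /\
  Aut (E3 R) = [set 1%:M; mx22 0 1 1 0] /\
  Aut (E4 R) = [set 1%:M; mx22 1 0 0 (-1)] /\
  Aut (E5 R) = [set 1%:M; mx22 1 0 0 (-1)] /\
  Aut (E6 R) =
    [set mx22 t (1 - t) (1 - t) t | t in [set t : R | t != 1 / 2]] /\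
  Aut (E7 R) =
    [set g : 'M[R]_2 | exists t s : R, t != 0 /\ g = mx22 (t ^+ 2) s 0 t].
Proof.
split=> [b c bc1 bc|].
  apply/seteqP; split; last by move=> _ ->; exact: Aut_mx24_1.
  by move=> g /(Aut_E1 bc1)[//|[bcE]]; rewrite bcE eqxx in bc.
split=> [b b1|].
  apply/seteqP; split.
  - by move=> g /Aut_E1; rewrite -expr2 => /(_ b1)[->|[_ ->]]; [left|right].
  - move=> _ [->|->]; first exact: Aut_mx24_1.
    apply/Aut_mx24P; split; [|split; ring..].
    by rewrite mul0r mul1r sub0r oppr_eq0 oner_eq0.
split; first exact: Aut_E2.
split; first exact: Aut_E2_0.
split; first exact: Aut_E3.
split; first by apply: Aut_e2_sign; exact: oner_neq0.
split; first by apply: Aut_e2_sign; rewrite oppr_eq0 oner_eq0.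
split; [exact: Aut_E6|exact: Aut_E7].
Qed.
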